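(* Let $n\ge 1$, let $\sigma\in\mathscr{S}_n$ be a permutation, let $\alpha=(\alpha_1,\ldots,\alpha_n)$ be a weak composition with $n$ parts, and suppose $\alpha_i=\alpha_{i+1}$ for some $i\in\{1,\ldots,n-1\}$. Then $$E_{\alpha}^{\sigma}(\mathbf{x};q,t)=E_{\alpha}^{\sigma s_i}(\mathbf{x};q,t),$$ where $E_\alpha^\sigma$ denotes the permuted-basement Macdonald polynomial of shape $\alpha$ and basement $\sigma$.
   Context: Fix $n$, write $[k]=\{1,\ldots,k\}$, and let $\mathbf{x}=(x_1,\ldots,x_n)$; polynomials lie in $\mathbb{Q}(q,t)[x_1,\ldots,x_n]$. A (weak) composition is a sequence $\alpha=(\alpha_1,\ldots,\alpha_n)$ of $n$ nonnegative integers. Permutations $\sigma\in\mathscr{S}_n$ are written in one-line notation $[\sigma_1,\ldots,\sigma_n]$; $s_i$ is the simple transposition exchanging $i$ and $i+1$, and $\sigma s_i=[\sigma_1,\ldots,\sigma_{i+1},\sigma_i,\ldots,\sigma_n]$ (the entries in positions $i$ and $i+1$ are swapped). Diagrams. $\mathrm{dg}(\alpha)=\{(i,r): i\in[n],\ r\in[\alpha_i]\}$, where $(i,r)$ is the box in column $i$ and row $r$. The augmented diagram is $\widehat{\mathrm{dg}}(\alpha)=\mathrm{dg}(\alpha)\cup\{(i,0): i\in[n]\}$; row $0$ is called the basement. For $u=(i,r)\in\mathrm{dg}(\alpha)$: $d(u)=(i,r-1)$; $\mathrm{leg}(u)=\alpha_i-r$; $$\mathrm{Arm}(u)=\{(j,r-1)\in\widehat{\mathrm{dg}}(\alpha):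 j<i,\ \alpha_j<\alpha_i\}\cup\{(j,r)\in\mathrm{dg}(\alpha): j>i,\ \alpha_j\le\alpha_i\};$$ and $\mathrm{arm}(u)=|\mathrm{Arm}(u)|$. Fillings. An augmented filling of shape $\alpha$ and basement $\sigma$ is a map $T:\widehat{\mathrm{dg}}(\alpha)\to[n]$ with $T(i,0)=\sigma_i$ for all $i\in[n]$. A box $u=(i_u,r_u)$ attacks a box $v=(i_v,r_v)$ (boxes of $\widehat{\mathrm{dg}}(\alpha)$) if either $r_u=r_v$ and $i_u<i_v$, or $r_v=r_u-1$ and $i_v<i_u$. $T$ is non-attacking if $T(u)\ne T(v)$ whenever $u$ attacks $v$. $\mathrm{NAF}(\alpha,\sigma)$ is the set of non-attacking augmented fillings of shape $\alpha$ and basement $\sigma$. Statistics. $\mathbf{x}^T=\prod_{u\in\mathrm{dg}(\alpha)}x_{T(u)}$. $\mathrm{Des}(T)=\{u\in\mathrm{dg}(\alpha): T(u)>T(d(u))\}$ and $\mathrm{maj}(T)=\sum_{u\in\mathrm{Des}(T)}(\mathrm{leg}(u)+1)$. For $a,b\in[n]$ let $\chi_{a,b}=1$ if $a>b$ and $0$ otherwise, and let $\chi_{a,b,c}=\chi_{a,b}+\chi_{b,c}-\chi_{a,c}\in\{0,1\}$. A triple is $(u,v,w)$ with $u\in\mathrm{dg}(\alpha)$, $v\in\mathrm{Arm}(u)$, $w=d(u)$. $\mathrm{coinv}(T)$ is the number of triples with $\chi_{T(u),T(v),T(w)}=0$. The permuted-basement Macdonald polynomial is $$E_\alpha^\sigma(\mathbf{x};q,t)=\sum_{T\in\mathrm{NAF}(\alpha,\sigma)}\mathbf{x}^Tq^{\mathrm{maj}(T)}t^{\mathrm{coinv}(T)}\prod_{\substack{u\in\mathrm{dg}(\alpha)\\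 T(u)\ne T(d(u))}}\frac{1-t}{1-q^{1+\mathrm{leg}(u)}t^{1+\mathrm{arm}(u)}}.$$ *)

(* Defs.v *)
From HB Require Import structures.
From mathcomp Require Import all_boot all_order all_algebra all_fingroup.
From mathcomp Require Import fraction mpoly.

Set Implicit Arguments.
Unset Strict Implicit.
Unset Printing Implicit Defensive.

Import GRing.Theory.
Local Open Scope ring_scope.

(* The field Q(q,t), as the field of fractions of Q[q,t]. *)
Definition Qqt : fieldType := {fraction {mpoly rat[2]}}.
Definition q : Qqt := tofrac 'X_(@Ordinal 2 0 isT).
Definition t : Qqt := tofrac 'X_(@Ordinal 2 1 isT).

(* Columns, entries and variables are indexed from 0: 'I_n stands for [n].
   Only the relative order of these indices is ever used.  Rows keep their
   usual numbers, row 0 being the basement. *)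
Section Diagram.
Variables (n : nat) (alpha : 'I_n -> nat).

(* A box of the augmented diagram: a column i and a row r with r <= alpha i. *)
Definition box : finType := {i : 'I_n & 'I_(alpha i).+1}.
Definition mkbox (i : 'I_n) (r : 'I_(alpha i).+1) : box :=
  Tagged (fun i => 'I_(alpha i).+1) r.
Definition col (u : box) : 'I_n := tag u.
Definition row (u : box) : nat := tagged u.

Definition dg : {set box} := [set u | 0 < row u]%N.

(* The box (i, r - 1) below (i, r); only used for boxes outside the basement
   (a basement box is sent to itself). *)
Definition down (u : box) : box :=
  mkbox (Ordinal (leq_ltn_trans (leq_pred (tagged u)) (ltn_ord (tagged u)))).

Definition leg (u : box) : nat := (alpha (col u) - row u)%N.

Definition Arm (u : box) : {set box} :=
  [set v : box | [&& (row v).+1 == row u, (col v < col u)%N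
                   & (alpha (col v) < alpha (col u))%N]]
  :|: [set v in dg | [&& row v == row u, (col u < col v)%N
                       & (alpha (col v) <= alpha (col u))%N]].

Definition arm (u : box) : nat := #|Arm u|.

Definition attacks (u v : box) : bool :=
  ((row u == row v) && (col u < col v)%N)
  || ((row u == (row v).+1) && (col v < col u)%N).

Definition filling : finType := {ffun box -> 'I_n}.

Definition nonattacking (T : filling) : bool :=
  [forall u : box, forall v : box, attacks u v ==> (T u != T v)].

Definition NAF (sigma : 'S_n) : {set filling} :=
  [set T : filling | [forall i : 'I_n, T (@mkbox i ord0) == sigma i]
                     && nonattacking T].

Definition Des (T : filling) : {set box} :=
  [set u in dg | (T (down u) < T u)%N].

Definition maj (T : filling) : nat := (\sum_(u in Des T) (leg u).+1)%N.

Definition chi (a b : 'I_n) : int := (b < a)%N%:Z.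
Definition chi3 (a b c : 'I_n) : int := chi a b + chi b c - chi a c.

(* A triple (u, v, down u) is recorded by the pair (u, v). *)
Definition coinv (T : filling) : nat :=
  #|[set p : box * box | [&& p.1 \in dg, p.2 \in Arm p.1
                           & chi3 (T p.1) (T p.2) (T (down p.1)) == 0]]|.

Definition xmonomial (T : filling) : {mpoly Qqt[n]} :=
  \prod_(u in dg) 'X_(T u).

Definition weight (T : filling) : Qqt :=
  q ^+ maj T * t ^+ coinv T *
  \prod_(u in dg | T u != T (down u))
     ((1 - t) / (1 - q ^+ (1 + leg u) * t ^+ (1 + arm u))).

Definition permuted_basement_macdonald (sigma : 'S_n) : {mpoly Qqt[n]} :=
  \sum_(T in NAF sigma) weight T *: xmonomial T.

End Diagram.

(* Main.v *)
From Pilot Require Import Defs.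
From mathcomp Require Import all_boot all_order all_algebra all_fingroup.
From mathcomp Require Import fraction mpoly zify ring.
(* [row] and [col] must mean the coordinates of a box, not those of a matrix. *)
Import Pilot.Defs.

Set Implicit Arguments.
Unset Strict Implicit.
Unset Printing Implicit Defensive.

Import GRing.Theory.
Local Open Scope ring_scope.

(** Each box of a filling T contributes to the weight of T through its own
    row and the row below only, so that weight is a product of row weights
    W_r(T), where W_r depends on the entries in rows r and r - 1
    ([macdonaldE]).  Let tau_r exchange the two entries of row r in the
    adjacent columns i and i' of equal height.

    The heart of the matter is local: the symmetrized row weight
    W_r(T) + W_r(tau_r T) does not change when T is replaced by tau_(r-1) T
    ([row_weight_symmetrized]).  Boxes in the other columns cannot tell the two
    columns apart: of the two boxes that these columns have in a row, they
    attack both or neither, and their arm contains both or neither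
    ([attacks_box_swap], [Arm_box_swap]).  The
    two boxes of row r in columns i and i' have the same arm, except that the
    left box also has the right one in its arm, and the same attacked boxes in
    other columns.  Once the factors that depend on a single entry are pulled
    out ([pair_box_weight]), what remains is a function of the four entries
    a, b (below) and c, d (above) and of y = q^(leg + 1) t^arm, and its sum over
    the two orders of c, d is symmetric in a, b by a rational identity that
    depends only on the relative order of the entries ([pair_weight_swap]).

    The local statement propagates from the top row downwards
    ([sum_prod_symmetrize]).  Only the weight of the top row involves the order
    of the two entries in that row, so summing over fillings allows replacing
    that weight by its average under tau; this average is blind to the order in
    the next row too, so it can be treated as a constant there and the argument
    repeats.  In the end E is a sum over fillings with basement sigma of
    x^T times a product of averages, all of which are invariant under tau_0
    ([macdonald_symmetrized]); and tau_0 turns the basement sigma into the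
    basement of the other side. *)

(** * Nonvanishing in Q(q,t) *)

(** Evaluating at one rational point is enough to see that an element of
    Q[q,t] does not vanish in the fraction field. *)
Lemma tofrac_meval_neq0 (p : {mpoly rat[2]}) (v : 'I_2 -> rat) :
  p.@[v] != 0 -> tofrac p != 0 :> Qqt.
Proof. by apply: contraNneq => /eqP; rewrite tofrac_eq0 => /eqP->; rewrite meval0. Qed.

Lemma t_neq0 : t != 0.
Proof. by apply: (@tofrac_meval_neq0 _ (fun=> 1)); rewrite mevalXU. Qed.

Lemma two_neq0 : 2%:R != 0 :> Qqt.
Proof.
rewrite -(rmorph_nat (@tofrac _)); apply: (@tofrac_meval_neq0 _ (fun=> 1)).
by rewrite rmorph_nat.
Qed.

(** The power of q is positive, so the value at q = t = 0 is 1. *)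
Lemma hook_neq0 l m : 1 - q ^+ (1 + l) * t ^+ m != 0.
Proof.
rewrite -!rmorphXn -rmorphM -(rmorph1 (@tofrac _)) -rmorphB.
apply: (@tofrac_meval_neq0 _ (fun=> 0)).
by rewrite mevalB meval1 mevalM !rmorphXn /= !mevalXU add1n exprS !mul0r subr0 oner_eq0.
Qed.

(** * Averaging a product of weights one factor at a time *)

(** Since [W r] is unchanged by [tau s] for s > r, the last factor is the only
    one moved by the last involution, so reindexing along it replaces that
    factor by its average [Ws].  The average is invariant under every [tau s]
    and can therefore be absorbed into [R], which gives an induction on [m]. *)
Lemma sum_prod_symmetrize (F : fieldType) (V : lmodType F) (X : finType)
    (P : pred X) (tau : nat -> X -> X) (W : nat -> X -> F) (R : X -> V) m
    (Ws := fun r x => 2%:R^-1 * (W r x + W r (tau r x))) :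
  2%:R != 0 :> F ->
  (forall s, involutive (tau s)) ->
  (forall s x, P (tau s x) = P x) ->
  (forall s x, R (tau s x) = R x) ->
  (forall r s x, (r < s)%N -> W r (tau s x) = W r x) ->
  (forall r s x, Ws r (tau s x) = Ws r x) ->
  \sum_(x | P x) (\prod_(r < m) W r x) *: R x =
  \sum_(x | P x) (\prod_(r < m) Ws r x) *: R x.
Proof.
move=> two0 tauK Ptau + Wtau Wstau; elim: m R => [|m IHm] R Rtau.
  by apply: eq_bigr => x _; rewrite !big_ord0.
transitivity (\sum_(x | P x) (\prod_(r < m) W r x) *: (Ws m x *: R x)); last first.
  rewrite IHm => [|s x]; last by rewrite Wstau Rtau.
  by apply: eq_bigr => x _; rewrite big_ord_recr scalerA.
set S := LHS; apply: (scalerI two0); rewrite scaler_nat mulr2n.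
have {2}-> : S = \sum_(x | P x) (\prod_(r < m) W r x) *: (W m (tau m x) *: R x).
  rewrite /S (reindex_inj (inv_inj (tauK m))); apply: eq_big => [x|x _].
    exact: Ptau.
  rewrite big_ord_recr /= Rtau scalerA; congr (_ * _ *: _).
  by apply: eq_bigr => r _; rewrite Wtau.
rewrite -big_split scaler_sumr; apply: eq_bigr => x _ /=.
rewrite big_ord_recr /= !scalerA -scalerDl /Ws; congr (_ *: _); field.
by rewrite two0.
Qed.

(** * The two-column identity *)

(** The part of the weight of two horizontally adjacent boxes with entries c, d,
    above entries a, b, that involves more than one entry.  Here y stands for
    q^(leg + 1) t^N, where N is the arm of the right box; the arm of the left
    box is N + 1, hence the two denominators.  The conditions c <> d and d <> a
    are the attacks among the four boxes, and the bare power of t counts the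
    coinversion of the triple (c, d, a). *)
Definition pair_weight (F : fieldType) (t y : F) (a b c d : nat) : F :=
  ((c != d) && (d != a))%:R * y ^+ ((a < c) + (b < d))
  * t ^+ ((d < c) + (a < d) == (a < c) :> nat)%N
  * (if c == a then 1 else (1 - t) / (1 - y * t ^+ 2))
  * (if d == b then 1 else (1 - t) / (1 - y * t)).

(** Both sides are symmetric under exchanging c and d, and the identity itself
    under exchanging a and b, so one may assume a < b and c < d.  What remains
    is a rational identity for each relative position of c and d with respect
    to a and b. *)
Lemma pair_weight_swap (F : fieldType) (t y : F) (a b c d : nat) :
  1 - y * t != 0 -> 1 - y * t ^+ 2 != 0 ->
  pair_weight t y a b c d + pair_weight t y a b d c =
  pair_weight t y b a c d + pair_weight t y b a d c.
Proof.
move=> y1 y2.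
wlog ltab : a b / (a < b)%N => [hw|].
  by case: (ltngtP a b) => [|/hw ->|->]; first exact: hw.
wlog ltcd : c d / (c < d)%N => [hw|].
  case: (ltngtP c d) => [|/hw H|->]; first exact: hw.
    by rewrite addrC H addrC.
  by rewrite /pair_weight eqxx !mul0r.
have cmp m p :
  (m < p)%N -> (p < m)%N = false /\ ((m == p) = false /\ (p == m) = false) by lia.
rewrite /pair_weight ltcd.
have [dc [e1 e2]] := cmp _ _ ltcd; have [ba [e3 e4]] := cmp _ _ ltab.
rewrite dc e1 e2.
case: (ltngtP a c) => ac; case: (ltngtP b c) => bc;
  case: (ltngtP a d) => ad; case: (ltngtP b d) => bd; try lia;
  rewrite /= ?expr0 ?expr1 ?mulr0 ?mul0r ?mulr1 ?mul1r ?addr0 ?add0r //;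
  by field; rewrite y1 y2.
Qed.

Lemma expr_split (F : fieldType) (t : F) (k p m N e : nat) :
  t != 0 -> (k + p = m + N * e)%N ->
  t ^+ k = t ^+ m * (t ^+ p)^-1 * (t ^+ N) ^+ e.
Proof.
move=> t0 E; have tp : t ^+ p != 0 by rewrite expf_neq0.
by apply: (mulIf tp); rewrite -exprD E exprD exprM mulrAC mulfVK.
Qed.

(** The algebra behind [pair_box_weight]: [Q] is q^(leg + 1), [P] is t^N, and
    [tc], [td], [na], [nb], [xc], [xd] are the factors attached to one entry. *)
Lemma pair_weight_mul (F : fieldType) (t Q P tc td na nb : F) (a b c d : nat)
    (xc xd : bool) :
  ((c != d) && xc)%:R * Q ^+ (a < c)
   * (tc * na * P ^+ (a < c) * t ^+ ((d < c) + (a < d) == (a < c) :> nat)%N)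
   * (if c == a then 1 else (1 - t) / (1 - Q * P * t ^+ 2))
  * (((d != a) && xd)%:R * Q ^+ (b < d) * (td * nb * P ^+ (b < d))
   * (if d == b then 1 else (1 - t) / (1 - Q * P * t)))
  = xc%:R * tc * (xd%:R * td) * (na * nb) * pair_weight t (Q * P) a b c d.
Proof.
rewrite /pair_weight -!mulnb !natrM exprD !exprMn; ring.
Qed.

(** * The weight of a filling as a product over rows *)

Section Boxes.
Variables (n : nat) (alpha : 'I_n -> nat).
Implicit Types (u v : box alpha) (T : filling alpha).

Lemma box_eq u v : col u = col v -> row u = row v -> u = v.
Proof.
case: u => j x; case: v => k y; rewrite /col /row /= => ejk.
by case: _ / ejk y => y /val_inj ->.
Qed.

Definition clear T u : bool := [forall v, attacks u v ==> (T u != T v)].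

(** The factor 0 for a box that collides with a box it attacks makes it possible
    to sum over all fillings with a given basement: being non-attacking is not
    preserved by exchanging two entries. *)
Definition box_weight T u : Qqt :=
  (clear T u)%:R * q ^+ ((leg u).+1 * (T (down u) < T u))
  * t ^+ #|[set v in Arm u | chi3 (T u) (T v) (T (down u)) == 0]|
  * (if T u == T (down u) then 1
     else (1 - t) / (1 - q ^+ (1 + leg u) * t ^+ (1 + arm u))).

Definition row_weight r T : Qqt :=
  \prod_(u in dg alpha | row u == r) box_weight T u.

Definition has_basement (sigma : 'S_n) T : bool :=
  [forall i, T (@mkbox n alpha i ord0) == sigma i].

Lemma coinvE T :
  coinv T =
  (\sum_(u in dg alpha) #|[set v in Arm u | chi3 (T u) (T v) (T (down u)) == 0]|)%N.
Proof.
under eq_bigr do rewrite -sum1_card.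
rewrite pair_big_dep /coinv -sum1_card /=.
by apply: eq_bigl => -[u v]; rewrite !inE /= ?inE.
Qed.

Lemma majE T :
  maj T = (\sum_(u in dg alpha) (leg u).+1 * (T (down u) < T u))%N.
Proof.
rewrite /maj big_mkcond [RHS]big_mkcond; apply: eq_bigr => u _.
rewrite !inE; case: (0 < row u)%N => //=.
by case: (T _ < T _)%N; rewrite ?muln1 ?muln0.
Qed.

Lemma prod_nat_bool (R : comNzRingType) (I : finType) (P b : pred I) :
  \prod_(j | P j) (b j)%:R = [forall (j | P j), b j]%:R :> R.
Proof.
case: forallP => [bP|nbP].
  by rewrite big1 // => j Pj; move/implyP: (bP j) => ->.
have [j] : exists j, P j && ~~ b j.
  apply/existsP; apply: contra_notT nbP => /existsPn nex j.
  by apply/implyP => Pj; move: (nex j); rewrite Pj negbK.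
by case/andP=> Pj /negbTE bj; rewrite (bigD1 j) //= bj mul0r.
Qed.

(** Basement boxes attack only basement boxes, whose entries differ because
    sigma is injective. *)
Lemma nonattackingE sigma T :
  has_basement sigma T ->
  nonattacking T = [forall (u | u \in dg alpha), clear T u].
Proof.
move=> /forallP bT; apply/forallP/forallP => [cT u|cT u].
  by apply/implyP => _; exact: cT.
have [u0|] := posnP (row u); last first.
  by move=> ru; have /implyP := cT u; apply; rewrite inE.
apply/forallP => v; apply/implyP; rewrite /attacks u0 => /orP[|//].
case/andP=> v0 uv.
have basE w : row w = 0 -> T w = sigma (col w).
  move=> w0; rewrite -(eqP (bT (col w))); congr (T _).
  exact: box_eq.
rewrite (basE u u0) (basE v (esym (eqP v0))) (inj_eq perm_inj).
by apply: contraTneq uv => ->; rewrite ltnn.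
Qed.

Lemma weightE sigma T : has_basement sigma T ->
  (nonattacking T)%:R * weight T = \prod_(u in dg alpha) box_weight T u.
Proof.
move=> bT; rewrite (nonattackingE bT) -prod_nat_bool !big_split /=.
rewrite /weight majE coinvE !expr_sum !mulrA; congr (_ * _).
rewrite big_mkcondr /=; apply: eq_bigr => u _.
by case: eqP.
Qed.

Lemma prod_rows T :
  \prod_(u in dg alpha) box_weight T u =
  \prod_(r < (\max_j alpha j).+1) row_weight r.+1 T.
Proof.
rewrite (partition_big
  (fun u => inord (row u).-1 : 'I_(\max_j alpha j).+1) predT) //=.
apply: eq_bigr => r _; apply: eq_bigl => u; rewrite inE.
case: posnP => //= u_gt0; rewrite -val_eqE /= inordK.
  by rewrite -eqSS prednK.
rewrite prednK //; apply: leq_trans (leqnSn _).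
apply: leq_trans (leq_bigmax (col u)).
by rewrite -ltnS; exact: ltn_ord.
Qed.

Lemma macdonaldE sigma :
  permuted_basement_macdonald alpha sigma =
  \sum_(T | has_basement sigma T)
    (\prod_(r < (\max_j alpha j).+1) row_weight r.+1 T) *: xmonomial T.
Proof.
rewrite /permuted_basement_macdonald.
rewrite (eq_bigl (fun T => has_basement sigma T && nonattacking T)); last first.
  by move=> T; rewrite inE.
rewrite big_mkcondr; apply: eq_bigr => T bT.
rewrite -prod_rows -(weightE bT); case: nonattacking; rewrite ?mul1r //.
by rewrite mul0r scale0r.
Qed.

Lemma chi3_eq0 (a b c : 'I_n) :
  (chi3 a b c == 0) = ((b < a) + (c < b) == (c < a) :> nat)%N.
Proof. by rewrite /chi3 /chi; lia. Qed.

(** Entry by entry, [chi3 c v a = 0] + [a < v] = [c <= v] + [a < c].  This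
    separates the number of coinversions into a function of c, a function of a
    and #|A| for each descent. *)
Lemma card_triples T (A : {set box alpha}) (c a : 'I_n) :
  (#|[set v in A | chi3 c (T v) a == 0]| + #|[set v in A | a < T v]| =
   #|[set v in A | c <= T v]| + #|A| * (a < c))%N.
Proof.
have cardE (b : pred (box alpha)) : #|[set v in A | b v]| = (\sum_(v in A) b v)%N.
  rewrite -sum1_card [RHS]big_mkcond [LHS]big_mkcond; apply: eq_bigr => v _.
  by rewrite inE; case: (v \in A); case: (b v).
rewrite !cardE -sum_nat_const -!big_split; apply: eq_bigr => v _ /=.
rewrite chi3_eq0; lia.
Qed.

End Boxes.

(** * Exchanging the entries of two columns of equal height *)

Section EqualColumns.
Variables (n : nat) (alpha : 'I_n -> nat) (i i' : 'I_n).
Hypotheses (hi' : nat_of_ord i' = i.+1) (halpha : alpha i = alpha i').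
Implicit Types (u v : box alpha) (T : filling alpha).

Definition col_swap u : box alpha :=
  @mkbox n alpha (tperm i i' (col u)) (inord (row u)).

Lemma alpha_tperm j : alpha (tperm i i' j) = alpha j.
Proof. by case: tpermP => [->|->|]. Qed.

Lemma row_col_swap u : row (col_swap u) = row u.
Proof. by rewrite /row /= inordK // alpha_tperm; exact: ltn_ord. Qed.

Lemma col_col_swap u : col (col_swap u) = tperm i i' (col u).
Proof. by []. Qed.

Lemma col_swapK : involutive col_swap.
Proof. by move=> u; apply: box_eq; rewrite ?row_col_swap ?col_col_swap ?tpermK. Qed.

Definition box_swap s u : box alpha := if row u == s then col_swap u else u.

Lemma row_box_swap s u : row (box_swap s u) = row u.
Proof. by rewrite /box_swap; case: ifP; rewrite ?row_col_swap. Qed.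

Lemma box_swapK s : involutive (box_swap s).
Proof.
move=> u; rewrite {1}/box_swap row_box_swap /box_swap.
by case: eqP => // _; rewrite col_swapK.
Qed.

Definition outside u : bool := (col u != i) && (col u != i').

Lemma box_swap_outside s u : outside u -> box_swap s u = u.
Proof.
case/andP=> ui ui'; rewrite /box_swap; case: eqP => // _.
by apply: box_eq; rewrite ?row_col_swap ?col_col_swap // tpermD // eq_sym.
Qed.

Lemma alpha_box_swap s u : alpha (col (box_swap s u)) = alpha (col u).
Proof. by rewrite /box_swap; case: ifP; rewrite ?col_col_swap ?alpha_tperm. Qed.

(** No column lies strictly between the adjacent columns i and i'. *)
Lemma col_box_swap_cmp s u v : outside u ->
  (col (box_swap s v) < col u)%N = (col v < col u)%N /\
  (col u < col (box_swap s v))%N = (col u < col v)%N.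
Proof.
case/andP; rewrite -!val_eqE /= => ui ui'; rewrite /box_swap; case: eqP => // _.
rewrite col_col_swap; case: tpermP => [->|->|] //; lia.
Qed.

Lemma Arm_box_swap s u v : outside u -> (box_swap s v \in Arm u) = (v \in Arm u).
Proof.
move=> ou; have [lt gt] := col_box_swap_cmp s v ou.
by rewrite !inE !row_box_swap alpha_box_swap lt gt.
Qed.

Lemma attacks_box_swap s u v : outside u -> attacks u (box_swap s v) = attacks u v.
Proof.
move=> ou; have [lt gt] := col_box_swap_cmp s v ou.
by rewrite /attacks !row_box_swap lt gt.
Qed.

Definition row_swap s T : filling alpha := [ffun u => T (box_swap s u)].

Lemma row_swapE s T u : row_swap s T u = T (box_swap s u).
Proof. by rewrite ffunE. Qed.

Lemma row_swapK s : involutive (row_swap s).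
Proof. by move=> T; apply/ffunP => u; rewrite !ffunE box_swapK. Qed.

Lemma row_swap_outside s T u : outside u -> row_swap s T u = T u.
Proof. by move=> ou; rewrite row_swapE box_swap_outside. Qed.

Lemma has_basement_swap_pos sigma s T :
  has_basement sigma (row_swap s.+1 T) = has_basement sigma T.
Proof. by apply: eq_forallb => j; rewrite row_swapE. Qed.

Lemma has_basement_swap0 sigma T :
  has_basement sigma (row_swap 0 T) = has_basement (tperm i i' * sigma)%g T.
Proof.
have E j : row_swap 0 T (@mkbox n alpha j ord0) = T (@mkbox n alpha (tperm i i' j) ord0).
  by rewrite row_swapE; congr (T _); apply: box_eq; rewrite ?row_box_swap.
apply/forallP/forallP => bT j.
  by rewrite permM; have := bT (tperm i i' j); rewrite E tpermK.
by rewrite E; have := bT (tperm i i' j); rewrite permM tpermK.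
Qed.

Lemma xmonomial_swap s T : xmonomial (row_swap s T) = xmonomial T.
Proof.
rewrite /xmonomial [RHS](reindex_inj (inv_inj (box_swapK s))).
apply: eq_big => [u|u _]; last by rewrite row_swapE.
by rewrite !inE row_box_swap.
Qed.

Lemma clear_swap_outside s T u : outside u -> clear (row_swap s T) u = clear T u.
Proof.
move=> ou; apply/forallP/forallP => cT v.
  have := cT (box_swap s v).
  by rewrite attacks_box_swap // (row_swapE _ _ (box_swap s v)) box_swapK row_swap_outside.
have := cT (box_swap s v).
by rewrite attacks_box_swap // (row_swapE _ _ v) row_swap_outside.
Qed.

(** The coinversions at u are counted over its arm, which the exchange of two
    boxes in a row permutes. *)
Lemma box_weight_swap_outside s T u : outside u ->
  box_weight (row_swap s T) u = box_weight T u.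
Proof.
move=> ou; rewrite /box_weight clear_swap_outside // !row_swap_outside //.
congr (_ * t ^+ _ * _).
rewrite -!sum1_card [RHS](reindex_inj (inv_inj (box_swapK s))).
by apply: eq_bigl => v; rewrite [LHS]in_set [RHS]in_set Arm_box_swap // row_swapE.
Qed.

(** * The two exchanged boxes of one row *)

(** [u] and [u'] are the boxes of one row in the columns i and i'. *)
Section Row.
Variables (u u' : box alpha).
Hypotheses (cu : col u = i) (cu' : col u' = i') (ruu' : row u' = row u)
  (u_gt0 : (0 < row u)%N).

(** Column i is as high as column i', so it does not contribute to the arm of
    the right box. *)
Lemma Arm_outside v : v \in Arm u' -> outside v.
Proof.
rewrite !inE /outside cu' -halpha.
have [->|] := eqVneq (col v) i; first by lia.
rewrite -!val_eqE /=; lia.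
Qed.

Lemma right_notin_Arm : u' \notin Arm u'.
Proof. by rewrite !inE; lia. Qed.

Lemma ArmE : Arm u = u' |: Arm u'.
Proof.
apply/setP => v; rewrite !inE cu cu' ruu' -halpha.
have [->|neq] /= := eqVneq v u'; first by rewrite cu' -halpha ruu' u_gt0; lia.
have : ~~ ((col v == i') && (row v == row u)).
  apply: contraNN neq => /andP[/eqP cv /eqP rv].
  by apply/eqP/box_eq; rewrite ?cu' ?ruu'.
rewrite -val_eqE /=.
have [->|nvi] := eqVneq (col v) i; first by lia.
have := nvi; rewrite -val_eqE /=; lia.
Qed.

Lemma arm_left : arm u = (arm u').+1.
Proof. by rewrite /arm ArmE cardsU1 right_notin_Arm. Qed.

Lemma leg_right : leg u' = leg u.
Proof. by rewrite /leg cu cu' ruu' halpha. Qed.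

(** The boxes in other columns that are attacked by [u], or equivalently by
    [u']. *)
Definition attacked_outside v : bool :=
  (row u == row v) && (i' < col v)%N || (row u == (row v).+1) && (col v < i)%N.

Lemma attacked_outsideP v : attacked_outside v -> outside v.
Proof. by rewrite /attacked_outside /outside -!val_eqE /=; lia. Qed.

Lemma attacks_left v : attacks u v = (v == u') || attacked_outside v.
Proof.
rewrite /attacks /attacked_outside cu.
have [->|neq] /= := eqVneq v u'; first by rewrite cu' ruu'; lia.
have : ~~ ((col v == i') && (row v == row u)).
  apply: contraNN neq => /andP[/eqP cv /eqP rv].
  by apply/eqP/box_eq; rewrite ?cu' ?ruu'.
rewrite -val_eqE /=; lia.
Qed.

Lemma attacks_right v : attacks u' v = (v == down u) || attacked_outside v.
Proof.
rewrite /attacks /attacked_outside cu' ruu'.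
have rd : row (down u) = (row u).-1 by [].
have cd : col (down u) = i by [].
have [->|neq] := eqVneq v (down u); first by rewrite cd rd; lia.
have : ~~ ((col v == i) && (row v == (row u).-1)).
  apply: contraNN neq => /andP[/eqP cv /eqP rv].
  by apply/eqP/box_eq; rewrite ?cd ?rd.
rewrite -val_eqE /=; lia.
Qed.

Definition avoids T (x : 'I_n) : bool :=
  [forall v, attacked_outside v ==> (x != T v)].

Lemma clear_split T w x :
  (forall v, attacks w v = (v == x) || attacked_outside v) ->
  clear T w = (T w != T x) && avoids T (T w).
Proof.
move=> aE; apply/forallP/andP => [cT|[neq /forallP aT] v].
  split; first by have := cT x; rewrite aE eqxx.
  by apply/forallP => v; have := cT v; rewrite aE; case: attacked_outside; rewrite ?orbT.
by have := aT v; rewrite aE; have [->|] := eqVneq v x.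
Qed.

(** [top_factor] and [bottom_factor] collect what depends on one upper, resp.
    lower, entry together with entries outside the two columns; they serve
    both boxes alike, which is why their product is symmetric. *)
Definition top_factor T (c : 'I_n) : Qqt :=
  (avoids T c)%:R * t ^+ #|[set v in Arm u' | (c <= T v)%N]|.

Definition bottom_factor T (a : 'I_n) : Qqt :=
  (t ^+ #|[set v in Arm u' | (a < T v)%N]|)^-1.

Lemma top_factor_swap s T c : top_factor (row_swap s T) c = top_factor T c.
Proof.
have -> : top_factor (row_swap s T) c =
    (avoids T c)%:R * t ^+ #|[set v in Arm u' | (c <= row_swap s T v)%N]|.
  rewrite /top_factor; congr (_ * _); congr (nat_of_bool _)%:R.
  apply: eq_forallb => v; case: (boolP (attacked_outside v)) => //= /attacked_outsideP ov.
  by rewrite row_swap_outside.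
rewrite /top_factor; congr (_ * t ^+ _); apply: eq_card => v.
rewrite [LHS]in_set [RHS]in_set; case: (boolP (v \in Arm u')) => //= /Arm_outside ov.
by rewrite row_swap_outside.
Qed.

Lemma bottom_factor_swap s T a : bottom_factor (row_swap s T) a = bottom_factor T a.
Proof.
rewrite /bottom_factor; congr (t ^+ _)^-1; apply: eq_card => v.
rewrite [LHS]in_set [RHS]in_set; case: (boolP (v \in Arm u')) => //= /Arm_outside ov.
by rewrite row_swap_outside.
Qed.

Lemma expr_triples T (c a : 'I_n) :
  t ^+ #|[set v in Arm u' | chi3 c (T v) a == 0]| =
  t ^+ #|[set v in Arm u' | (c <= T v)%N]| * bottom_factor T a
  * (t ^+ arm u') ^+ (a < c)%N.
Proof. exact: (expr_split t_neq0 (card_triples T (Arm u') c a)). Qed.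

(** The left box has one triple more: with the right box of its row. *)
Lemma expr_triples_left T :
  t ^+ #|[set v in Arm u | chi3 (T u) (T v) (T (down u)) == 0]| =
  t ^+ #|[set v in Arm u' | chi3 (T u) (T v) (T (down u)) == 0]| *
  t ^+ (chi3 (T u) (T u') (T (down u)) == 0).
Proof.
rewrite -exprD; congr (t ^+ _); rewrite addnC.
set P := [set v in Arm u' | _].
have inP v : (v \in P) = (v \in Arm u') && (chi3 (T u) (T v) (T (down u)) == 0).
  by rewrite /P [LHS]in_set.
have [e|e] := boolP (chi3 (T u) (T u') (T (down u)) == 0).
  have <- : u' |: P = [set v in Arm u | chi3 (T u) (T v) (T (down u)) == 0].
    apply/setP => v; rewrite [RHS]in_set ArmE !in_setU1 inP.
    by have [->|] := eqVneq v u'; rewrite ?e.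
  by rewrite cardsU1 inP (negbTE right_notin_Arm).
apply: eq_card => v; rewrite [LHS]in_set ArmE in_setU1 inP.
by have [->|] := eqVneq v u'; rewrite ?(negbTE e) ?(negbTE right_notin_Arm).
Qed.

Lemma pair_box_weight T :
  box_weight T u * box_weight T u' =
  top_factor T (T u) * top_factor T (T u') *
  (bottom_factor T (T (down u)) * bottom_factor T (T (down u'))) *
  pair_weight t (q ^+ (1 + leg u) * t ^+ arm u') (T (down u)) (T (down u')) (T u) (T u').
Proof.
rewrite -pair_weight_mul /box_weight.
rewrite (clear_split T attacks_left) (clear_split T attacks_right).
rewrite expr_triples_left !expr_triples chi3_eq0 arm_left leg_right.
have E1 : q ^+ (1 + leg u) * t ^+ arm u' * t = q ^+ (1 + leg u) * t ^+ (1 + arm u').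
  by rewrite -mulrA -exprSr.
have E2 : q ^+ (1 + leg u) * t ^+ arm u' * t ^+ 2 =
    q ^+ (1 + leg u) * t ^+ (1 + (arm u').+1).
  by rewrite -mulrA -exprD (addnC _ 2).
by rewrite E1 E2 -(add1n (leg u)) !exprM.
Qed.

Definition symmetric_factor T (a b c d : 'I_n) : Qqt :=
  top_factor T c * top_factor T d * (bottom_factor T a * bottom_factor T b) *
  \prod_(w in dg alpha | (row w == row u) && outside w) box_weight T w.

Lemma symmetric_factor_swap s T a b c d :
  symmetric_factor (row_swap s T) a b c d = symmetric_factor T a b c d.
Proof.
rewrite /symmetric_factor !top_factor_swap !bottom_factor_swap; congr (_ * _).
by apply: eq_bigr => w /and3P[_ _ ow]; rewrite box_weight_swap_outside.
Qed.

Lemma row_weightE T :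
  row_weight (row u) T =
  symmetric_factor T (T (down u)) (T (down u')) (T u) (T u') *
  pair_weight t (q ^+ (1 + leg u) * t ^+ arm u') (T (down u)) (T (down u')) (T u) (T u').
Proof.
have uu' : u' != u.
  by apply/eqP => e; have := hi'; rewrite -cu' e cu; lia.
rewrite /row_weight (bigD1 u) /=; last by rewrite inE u_gt0 eqxx.
rewrite (bigD1 u') /=; last by rewrite inE ruu' u_gt0 eqxx uu'.
rewrite mulrA pair_box_weight [RHS]mulrAC; congr (_ * _).
apply: eq_bigl => w; rewrite -!andbA; case: (w \in dg alpha) => //=.
have [rw|] //= := eqVneq (row w) (row u); rewrite /outside.
congr (~~ _ && ~~ _); apply/eqP/eqP => [->|cw] //; apply: box_eq; by rewrite ?cw ?rw.
Qed.

Lemma col_swap_left : col_swap u = u'.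
Proof. by apply: box_eq; rewrite ?row_col_swap // col_col_swap cu tpermL. Qed.

Lemma col_swap_down : col_swap (down u) = down u'.
Proof.
apply: box_eq; first by rewrite col_col_swap [col (down u)]cu tpermL -cu'.
by rewrite row_col_swap -[LHS]/(row u).-1 -[RHS]/(row u').-1 ruu'.
Qed.

Lemma row_swap_values s T :
  [/\ row_swap s T u = T (if row u == s then u' else u),
      row_swap s T u' = T (if row u == s then u else u'),
      row_swap s T (down u) = T (if (row u).-1 == s then down u' else down u) &
      row_swap s T (down u') = T (if (row u).-1 == s then down u else down u')].
Proof.
have rd : row (down u) = (row u).-1 by [].
have rd' : row (down u') = (row u).-1 by rewrite -ruu'.
rewrite !row_swapE /box_swap ruu' rd rd'.
have right : col_swap u' = u by rewrite -col_swap_left col_swapK.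
have down_right : col_swap (down u') = down u by rewrite -col_swap_down col_swapK.
by rewrite col_swap_left col_swap_down right down_right.
Qed.

Lemma row_weight_swap_above s T :
  (row u < s)%N -> row_weight (row u) (row_swap s T) = row_weight (row u) T.
Proof.
move=> us; rewrite !row_weightE symmetric_factor_swap.
have [-> -> -> ->] := row_swap_values s T.
have -> : (row u == s) = false by lia.
by have -> : ((row u).-1 == s) = false by lia.
Qed.

(** Exchanging row r only exchanges the two terms.  Exchanging row r - 1
    exchanges the two lower entries, which is [pair_weight_swap]; other rows do
    not enter at all. *)
Lemma row_weight_sym s T :
  row_weight (row u) (row_swap s T) +
  row_weight (row u) (row_swap (row u) (row_swap s T)) =
  row_weight (row u) T + row_weight (row u) (row_swap (row u) T).
Proof.
have [<-|su] := eqVneq (row u) s; first by rewrite row_swapK addrC.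
set y := q ^+ (1 + leg u) * t ^+ arm u'.
have u1u : ((row u).-1 == row u) = false by lia.
have symE T0 : row_weight (row u) T0 + row_weight (row u) (row_swap (row u) T0) =
   symmetric_factor T0 (T0 (down u)) (T0 (down u')) (T0 u) (T0 u') *
   (pair_weight t y (T0 (down u)) (T0 (down u')) (T0 u) (T0 u')
   + pair_weight t y (T0 (down u)) (T0 (down u')) (T0 u') (T0 u)).
  rewrite !row_weightE; have [-> -> -> ->] := row_swap_values (row u) T0.
  rewrite eqxx u1u symmetric_factor_swap mulrDr; congr (_ + _ * _).
  by rewrite /symmetric_factor (mulrC (top_factor _ (T0 u'))).
rewrite !symE; have [-> -> -> ->] := row_swap_values s T.
rewrite (negbTE su) symmetric_factor_swap.
case: eqP => // _; rewrite pair_weight_swap.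
- by rewrite /symmetric_factor (mulrC (bottom_factor _ (T (down u')))).
- by rewrite -mulrA -exprSr hook_neq0.
- by rewrite -mulrA -exprD hook_neq0.
Qed.
End Row.

Lemma column_boxes_in_row r : (0 < r <= alpha i)%N ->
  exists u u', [/\ col u = i, col u' = i', row u' = row u, row u = r & (0 < row u)%N].
Proof.
case/andP=> r0 ri.
exists (@mkbox n alpha i (inord r)), (@mkbox n alpha i' (inord r)).
by split; rewrite // /row /= !inordK // -?halpha.
Qed.

Lemma row_weight_swap_no_box r s T : ~~ (0 < r <= alpha i)%N ->
  row_weight r (row_swap s T) = row_weight r T.
Proof.
move=> nr; apply: eq_bigr => u /andP[]; rewrite inE => u0 /eqP ur.
apply: box_weight_swap_outside; move: nr; rewrite -ur u0 /=.
have := ltn_ord (tagged u); rewrite -/(row u) ltnS -/(col u) => le nle.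
by apply/andP; split; apply: contraNneq nle => e; [rewrite -e | rewrite halpha -e].
Qed.

Lemma row_weight_swap_higher r s T :
  (r < s)%N -> row_weight r (row_swap s T) = row_weight r T.
Proof.
have [rb|nr _] := boolP (0 < r <= alpha i)%N; last exact: row_weight_swap_no_box.
have [u [u' [cu cu' ruu' <- u0]]] := column_boxes_in_row rb.
exact: (row_weight_swap_above cu cu' ruu' u0).
Qed.

Lemma row_weight_symmetrized r s T :
  row_weight r (row_swap s T) + row_weight r (row_swap r (row_swap s T)) =
  row_weight r T + row_weight r (row_swap r T).
Proof.
have [rb|nr] := boolP (0 < r <= alpha i)%N; last by rewrite !row_weight_swap_no_box.
have [u [u' [cu cu' ruu' <- u0]]] := column_boxes_in_row rb.
exact: (row_weight_sym cu cu' ruu' u0).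
Qed.

Lemma macdonald_symmetrized sigma :
  permuted_basement_macdonald alpha sigma =
  \sum_(T | has_basement sigma T)
    (\prod_(r < (\max_j alpha j).+1)
       (2%:R^-1 * (row_weight r.+1 T + row_weight r.+1 (row_swap r.+1 T))))
    *: xmonomial T.
Proof.
rewrite macdonaldE.
apply: (sum_prod_symmetrize (tau := fun s => row_swap s.+1)
                            (W := fun r => @row_weight n alpha r.+1)).
- exact: two_neq0.
- by move=> s; apply: row_swapK.
- by move=> s T; apply: has_basement_swap_pos.
- by move=> s T; apply: xmonomial_swap.
- by move=> r s T rs; apply: row_weight_swap_higher.
- by move=> r s T; rewrite row_weight_symmetrized.
Qed.

End EqualColumns.

(** * The symmetry in the basement *)

(* In one-line notation sigma s_i is j |-> sigma (s_i j); MathComp composes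
   permutations left to right, so it is written tperm i i' * sigma. *)
Theorem theorem1p1 (n : nat) (hn : (1 <= n)%N) (sigma : 'S_n)
    (alpha : 'I_n -> nat) (i i' : 'I_n) (hi' : nat_of_ord i' = i.+1)
    (halpha : alpha i = alpha i') :
  permuted_basement_macdonald alpha sigma
  = permuted_basement_macdonald alpha (tperm i i' * sigma)%g.
Proof.
rewrite !(macdonald_symmetrized hi' halpha).
rewrite (reindex_inj (inv_inj (row_swapK halpha 0))).
apply: eq_big => [T|T _]; first exact: has_basement_swap0.
rewrite xmonomial_swap //; congr (_ *: _); apply: eq_bigr => r _.
by rewrite row_weight_symmetrized.
Qed.
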